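(* The $abc$ conjecture implies the $S$-integral weak Hall conjecture, i.e.\ the statement that for every finite set of rational primes $S$, every nonzero integer $D$ and every $\varepsilon>0$, any $S$-primitive solution $(x,y)$ of the equation \[ y^2 = x^3 + aD,\qquad x,y\in \mathbb{Z}, \quad a\in\mathbb{Z}\cap\mathcal{O}_S^\times, \] satisfies \[ \max(|x|^{1/2},|y|^{1/3}) = O_\varepsilon((N_SD)^{1+\varepsilon}). \] More explicitly, if the $abc$ conjecture holds for some $0<\varepsilon\leq 0.1$ with constant $K_\varepsilon$, then any $S$-primitive solution $(x,y)$ of the equation $y^2 = x^3 + aD$ with $x,y\in \mathbb{Z}$ and $a\in\mathbb{Z}\cap\mathcal{O}_S^\times$ satisfies \[ \max(|x|^{1/2},|y|^{1/3}) \leq K_\varepsilon^{1+10\varepsilon}(N_SD)^{1+12\varepsilon}. \]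
   Context: Let $S$ be a finite set of rational primes, $N_S=\prod_{p\in S}p$, $\mathcal{O}_S=\mathbb{Z}[1/N_S]$ the ring of $S$-integers and $\mathcal{O}_S^\times$ its group of units ($S$-units). Let $D\neq 0$ be an integer. A pair of integers $(x,y)$ is called $S$-primitive if there is no $p\in S$ such that $p^6$ divides both $x^3$ and $y^2$. The $abc$ conjecture states: for any $\varepsilon>0$ there is a constant $K_\varepsilon$ (depending only on $\varepsilon$) such that for all coprime integers $a,b,c$ with $a+b+c=0$ one has $\max(|a|,|b|,|c|)\leq K_\varepsilon\,\mathrm{rad}(abc)^{1+\varepsilon}$, where $\mathrm{rad}(abc)=\prod_{p\mid abc}p$. *)

(* Defs.v *)
From mathcomp Require Import all_boot all_order all_algebra finmap.
From mathcomp Require Import all_classical all_reals all_analysis.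

Set Implicit Arguments.
Unset Strict Implicit.
Unset Printing Implicit Defensive.

Import Order.TTheory GRing.Theory Num.Theory.

Local Open Scope ring_scope.

(* [primes 0] is empty, so [radical 0 = 1]; [abc_bound] excludes [a * b * c = 0]. *)
Definition radical (n : nat) : nat := (\prod_(p <- primes n) p)%N.

Definition abc_bound (R : realType) (eps K : R) : Prop :=
  forall a b c : int,
    a * b * c != 0 ->
    gcdz (gcdz a b) c = 1 ->
    a + b + c = 0 ->
    (Num.max (Num.max `|a| `|b|) `|c|)%:~R
      <= K * ((radical (absz (a * b * c)))%:R `^ (1 + eps)).

Definition abc_conjecture (R : realType) : Prop :=
  forall eps : R, 0 < eps -> exists K : R, abc_bound eps K.

Definition prime_set (S : {fset nat}) : Prop := forall p, p \in S -> prime p.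

Definition N_ (S : {fset nat}) : nat := (\prod_(p <- S) p)%N.

(* The ring Z[1/N_S], as a subset of the rationals. *)
Definition S_integers (S : {fset nat}) : set rat :=
  fun q => exists (m : int) (k : nat), q = m%:~R / (N_ S)%:R ^+ k.

Definition S_units (S : {fset nat}) : set rat :=
  fun u => S_integers S u /\ exists2 v, S_integers S v & u * v = 1.

Definition S_primitive (S : {fset nat}) (x y : int) : Prop :=
  ~ exists2 p, p \in S &
      ((p%:Z ^+ 6 %| x ^+ 3)%Z /\ (p%:Z ^+ 6 %| y ^+ 2)%Z).

Definition S_primitive_solution (S : {fset nat}) (D a x y : int) : Prop :=
  [/\ S_units S a%:~R, y ^+ 2 = x ^+ 3 + a * D & S_primitive S x y].

Definition hall_height (R : realType) (x y : int) : R :=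
  Num.max (`|x|%:~R `^ (2^-1)) (`|y|%:~R `^ (3^-1)).

(* D may be negative, so the real powers are those of N_S * |D|.
   C is chosen before S and D: the implied constant depends only on eps. *)
Definition S_integral_weak_hall (R : realType) : Prop :=
  forall eps : R, 0 < eps ->
  exists C : R,
  forall (S : {fset nat}) (D a x y : int),
    prime_set S -> D != 0 -> S_primitive_solution S D a x y ->
    hall_height R x y <= C * (((N_ S)%:Z * `|D|)%:~R `^ (1 + eps)).

(* Main.v *)
(* Let H be the maximum of |x|^(1/2) and |y|^(1/3), and g = gcd (x^3, y^2).
   Dividing x^3 + a D = y^2 by g gives an abc triple with radical Q, whence
   H^6 <= K g Q^(1+eps) <= K (g Q)^(1+eps).  Comparing valuations prime by prime,
   g Q divides x y N_S D: at primes of S this is S-primitivity, and outside S it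
   holds because a is an S-unit.  As |x y| <= H^5, we get
   H^(1-5 eps) <= K (N_S |D|)^(1+eps), and raising this to the power 1 + 10 eps
   gives the bound, since K >= 1. *)
Require Import Defs.
From mathcomp Require Import all_boot all_order all_algebra finmap.
From mathcomp Require Import all_classical all_reals all_analysis.
From mathcomp Require Import zify ring lra.

Set Implicit Arguments.
Unset Strict Implicit.
Unset Printing Implicit Defensive.

Import Order.TTheory GRing.Theory Num.Theory.

Local Open Scope ring_scope.

(** * Divisibility by comparing valuations *)

Lemma dvdn_from_logn (m n : nat) :
  (0 < m)%N -> (0 < n)%N ->
  (forall p, prime p -> (logn p m <= logn p n)%N) -> (m %| n)%N.
Proof.
move=> m_gt0 n_gt0 le_log; apply/gcdn_idPl.
apply: eqn_from_log => // [|p]; first by rewrite gcdn_gt0 m_gt0.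
rewrite logn_gcd //; apply/minn_idPl.
(* At a non-prime [p] the value of [logn] is 0 by default. *)
by have [/le_log//|p_npr] := boolP (prime p); rewrite [X in (X <= _)%N]lognE (negbTE p_npr).
Qed.

Lemma logn_gt0_dvd (p n : nat) :
  prime p -> (0 < n)%N -> (p %| n)%N = (0 < logn p n)%N.
Proof. by move=> p_pr n0; rewrite logn_gt0 mem_primes p_pr n0. Qed.

Lemma prod_primes_gt0 (s : seq nat) : all prime s -> (0 < \prod_(q <- s) q)%N.
Proof.
elim: s => [|q s IHs] /=; first by rewrite big_nil.
by move=> /andP[/prime_gt0 q0 /IHs s0]; rewrite big_cons muln_gt0 q0.
Qed.

(** Used twice: for [radical], with the list [primes n], and for [N_], with the elements of [S]. *)
Lemma logn_prod_primes (p : nat) (s : seq nat) :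
  uniq s -> all prime s -> logn p (\prod_(q <- s) q)%N = (p \in s).
Proof.
elim: s => [|q s IHs] /=; first by rewrite big_nil logn1.
move=> /andP[qNs us] /andP[q_pr s_pr]; rewrite big_cons.
rewrite lognM ?prod_primes_gt0 ?(prime_gt0 q_pr) // logn_prime // IHs // in_cons.
by case: eqP => [->|//]; rewrite (negbTE qNs).
Qed.

Lemma logn_radical (p n : nat) : logn p (radical n) = (p \in primes n).
Proof. by rewrite logn_prod_primes ?primes_uniq ?all_prime_primes. Qed.

Lemma radical_gt0 (n : nat) : (0 < radical n)%N.
Proof. exact/prod_primes_gt0/all_prime_primes. Qed.

(* The hypothesis [hp] bounds the valuation of [g] at a prime of [N] by 5, and
   min (3 i, 2 j) <= 5 implies min (3 i, 2 j) <= i + j; the one remaining factor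
   from the radical is paid for by [N].  At the other primes [g] divides [d]. *)
Lemma gcd_radical_dvd (N X Y A d u v w g : nat) :
  (0 < N)%N -> (0 < X)%N -> (0 < Y)%N -> (0 < A)%N -> (0 < d)%N ->
  (X ^ 3 = u * g)%N -> (A * d = v * g)%N -> (Y ^ 2 = w * g)%N ->
  g = gcdn (X ^ 3) (Y ^ 2) ->
  (forall p, prime p -> ~~ (p %| N)%N -> ~~ (p %| A)%N) ->
  (forall p, prime p -> (p %| N)%N ->
     ~~ ((p ^ 6 %| X ^ 3) && (p ^ 6 %| Y ^ 2))%N) ->
  (g * radical (u * v * w) %| X * Y * (N * d))%N.
Proof.
move=> N0 X0 Y0 A0 d0 eX eA eY eg hA hp.
have [] : [/\ (0 < g)%N, (0 < u)%N, (0 < v)%N & (0 < w)%N].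
  have X3 : (0 < X ^ 3)%N by rewrite expn_gt0 X0.
  have Y2 : (0 < Y ^ 2)%N by rewrite expn_gt0 Y0.
  have Ad : (0 < A * d)%N by rewrite muln_gt0 A0.
  move: X3 Y2 Ad; rewrite eX eA eY !muln_gt0.
  by move=> /andP[-> ->] /andP[-> _] /andP[-> _].
move=> g0 u0 v0 w0.
have M0 : (0 < u * v * w)%N by rewrite !muln_gt0 u0 v0 w0.
apply: dvdn_from_logn => [||p p_pr].
- by rewrite muln_gt0 g0 radical_gt0.
- by rewrite !muln_gt0 X0 Y0 N0 d0.
rewrite !lognM ?muln_gt0 ?X0 ?Y0 ?N0 ?d0 ?radical_gt0 //.
rewrite logn_radical -logn_gt0 !lognM ?muln_gt0 ?u0 ?v0 //.
have := congr1 (logn p) eX; have := congr1 (logn p) eY.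
have := congr1 (logn p) eA; have := congr1 (logn p) eg.
rewrite logn_gcd ?expn_gt0 ?X0 ?Y0 // !lognX !lognM //.
have := hp p p_pr; rewrite !pfactor_dvdn ?expn_gt0 ?X0 ?Y0 // !lognX.
have := hA p p_pr; rewrite !logn_gt0_dvd //.
lia.
Qed.

(** At a prime outside [N], all of [Y ^ m] comes from [d], so [d] has at least the valuation of [Y].
    At a prime of [N], [m] times the valuation of [Y] is below 6, hence below [m * k.+1], so that
    valuation is at most [k] and [N ^ k] absorbs it. *)
Lemma dvdn_of_pow_eq (N A d Y m k : nat) :
  (0 < N)%N -> (0 < Y)%N -> (0 < A)%N -> (0 < d)%N -> (0 < m)%N ->
  (A * d = Y ^ m)%N -> (6 <= m * k.+1)%N ->
  (forall p, prime p -> ~~ (p %| N)%N -> ~~ (p %| A)%N) ->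
  (forall p, prime p -> (p %| N)%N -> ~~ (p ^ 6 %| Y ^ m)%N) ->
  (0 < k)%N ->
  (Y %| (N * d) ^ k)%N.
Proof.
move=> N0 Y0 A0 d0 m0 eA mk hA hp k0.
have Nd0 : (0 < N * d)%N by rewrite muln_gt0 N0.
apply: dvdn_from_logn => // [|p p_pr]; first by rewrite expn_gt0 Nd0.
rewrite lognX lognM //.
have := congr1 (logn p) eA; rewrite lognX lognM //.
have := hp p p_pr; rewrite !pfactor_dvdn ?expn_gt0 ?Y0 // !lognX.
have := hA p p_pr; rewrite !logn_gt0_dvd //.
case: (posnP (logn p N)) => [->|N1] /= hA' hp' eA'.
  have A1 : logn p A = 0%N by lia.
  nia.
have : (m * logn p Y < m * k.+1)%N by have := hp' isT; lia.
by rewrite ltn_pmul2l //; nia.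
Qed.

(** * Real estimates: the lower bound on [K] and the extraction of the height *)

Lemma radical72 : radical 72 = 6%N.
Proof.
by rewrite /radical (_ : primes 72 = [:: 2; 3]%N) // !big_cons big_nil.
Qed.

(* The triple 1 + 8 = 9 has radical 6, and 6 ^ (6 / 5) < 9. *)
Lemma abc_bound_ge1 (R : realType) (eps K : R) :
  0 < eps -> eps <= 10^-1 -> abc_bound eps K -> 1 <= K.
Proof.
move=> e0 e1 /(_ 1 8 (- 9) isT erefl erefl).
rewrite (_ : absz _ = 72%N) // radical72 (_ : Num.max _ _ = 9) // => h9.
rewrite leNgt; apply/negP => K1.
have : 6 `^ (1 + eps) < 9 :> R.
  apply: (@le_lt_trans _ _ (6 `^ (6 / 5))).
    by apply: ler_powR; lra.
  (* Fifth powers: 6^6 = 46656 is less than 9^5 = 59049. *)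
  rewrite -(@ltr_pXn2r _ 5) ?nnegrE ?powR_ge0 //.
  rewrite -powR_mulrn ?powR_ge0 // -powRrM (_ : 6 / 5 * 5%:R = 6%:R); last by field.
  by rewrite powR_mulrn; lra.
have p0 : 0 < 6 `^ (1 + eps) :> R by apply: powR_gt0; lra.
by move: h9; rewrite -[9%:~R]/(9 : R); nra.
Qed.

Lemma descend_powR (R : realType) (eps K H Z : R) :
  0 < eps -> eps <= 10^-1 -> 1 <= K -> 1 <= H -> 1 <= Z ->
  H ^+ 6 <= K * (H ^+ 5 * Z) `^ (1 + eps) ->
  H <= K `^ (1 + 10 * eps) * Z `^ (1 + 12 * eps).
Proof.
move=> e0 e1 K1 H1 Z1 hH.
have H0 : 0 < H by lra.
have Hge0 := ltW H0; have Zge0 : 0 <= Z by lra.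
have Kge0 : 0 <= K by lra.
have {}hH : H `^ (1 - 5 * eps) <= K * Z `^ (1 + eps).
  (* Cancels the power of [H] on the right-hand side of the hypothesis. *)
  rewrite -(@ler_pM2r _ (H `^ (5 + 5 * eps))) ?powR_gt0 //.
  rewrite -powRD; last by rewrite [H == 0]gt_eqF ?implybT.
  rewrite (_ : 1 - _ + _ = 6%:R); last by ring.
  rewrite powR_mulrn //; apply: le_trans hH _.
  rewrite powRM ?exprn_ge0 //.
  rewrite -powR_mulrn // -powRrM (_ : 5%:R * (1 + eps) = 5 + 5 * eps); last by ring.
  by rewrite -mulrA [_ `^ _ * Z `^ _]mulrC.
(* (1 - 5 eps) (1 + 10 eps) >= 1 because eps <= 1 / 10. *)
have h1 : H <= H `^ ((1 - 5 * eps) * (1 + 10 * eps)).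
  rewrite -{1}[H]powRr1 //; apply: ler_powR => //; nra.
apply: (le_trans h1); rewrite powRrM.
apply: (@le_trans _ _ ((K * Z `^ (1 + eps)) `^ (1 + 10 * eps))).
  by apply: ge0_ler_powR; rewrite ?nnegrE ?mulr_ge0 ?powR_ge0 //; lra.
rewrite powRM ?powR_ge0 //.
(* (1 + eps) (1 + 10 eps) = 1 + 11 eps + 10 eps^2, and 10 eps^2 <= eps as eps <= 1 / 10. *)
rewrite ler_wpM2l ?powR_ge0 // -powRrM ler_powR //; nra.
Qed.

(** * Primes of [S], S-units and S-primitivity in terms of natural numbers *)

Section SUnits.
Variable S : {fset nat}.
Hypothesis S_prime : prime_set S.

Let S_all_prime : all prime S.
Proof. exact/allP. Qed.

Lemma N_gt0 : (0 < N_ S)%N.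
Proof. exact: prod_primes_gt0. Qed.

Lemma dvdn_N (p : nat) : prime p -> (p %| N_ S)%N = (p \in S).
Proof.
move=> p_pr; rewrite logn_gt0_dvd ?N_gt0 // /N_.
by rewrite logn_prod_primes ?fset_uniq //; case: (p \in _).
Qed.

Lemma S_units_neq0 (a : int) : S_units S a%:~R -> a != 0.
Proof.
move=> [_ [v _]]; apply: contra_eq_neq => ->.
by rewrite mul0r eq_sym oner_eq0.
Qed.

(** Writing the inverse of [a] as m / N_S^k gives a m = N_S^k in the integers, so every prime factor
    of [a] divides N_S. *)
Lemma S_units_dvdn (a : int) (p : nat) :
  S_units S a%:~R -> prime p -> ~~ (p %| N_ S)%N -> ~~ (p %| absz a)%N.
Proof.
move=> [_ [_ [m [k ->]] am]] p_pr; apply: contra => pa.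
have N0 : (N_ S)%:R != 0 :> rat by rewrite pnatr_eq0 -lt0n N_gt0.
have {}am : a * m = (N_ S)%:Z ^+ k.
  apply: (@intr_inj rat); rewrite rmorphM rmorphXn /=.
  by rewrite -[LHS](divfK (expf_neq0 k N0)) -[_ / _]mulrA am mul1r.
suff : (p %| N_ S ^ k)%N by rewrite Euclid_dvdX // => /andP[].
have /(congr1 absz) := am; rewrite abszM abszX /= => <-.
exact: dvdn_mulr.
Qed.

Lemma S_primitive_ndvd (x y : int) (p : nat) :
  S_primitive S x y -> prime p -> (p %| N_ S)%N ->
  ~~ ((p ^ 6 %| absz x ^ 3) && (p ^ 6 %| absz y ^ 2))%N.
Proof.
move=> prim p_pr; rewrite dvdn_N // => pS; apply/negP => /andP[px py].
by apply: prim; exists p => //; rewrite !dvdzE !abszX.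
Qed.

End SUnits.

(** * Integer powers of the Hall height *)

Section HallHeight.
Variable R : realType.
Implicit Types (x y : int) (B Z : R).

Lemma intr_norm_absz x : `|x|%:~R = (absz x)%:R :> R.
Proof. by rewrite -abszE. Qed.

Lemma powR_invK (r : R) (n : nat) : 0 <= r -> (r `^ n.+1%:R^-1) ^+ n.+1 = r.
Proof.
by move=> r0; rewrite -powR_mulrn ?powR_ge0 // -powRrM mulVf ?powRr1 ?pnatr_eq0.
Qed.

Lemma hall_height_ge0 x y : 0 <= hall_height R x y.
Proof. by rewrite le_max powR_ge0. Qed.

Lemma absz_le_hall_height x y :
  (absz x)%:R <= hall_height R x y ^+ 2 /\ (absz y)%:R <= hall_height R x y ^+ 3.
Proof.
(* The index of [powR_invK] is one less than the degree of the root: 1 is the square root, 2 the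
   cube root. *)
split; [rewrite -[leLHS](@powR_invK _ 1) | rewrite -[leLHS](@powR_invK _ 2)] => //;
  rewrite -intr_norm_absz;
  by rewrite ler_pXn2r ?nnegrE ?powR_ge0 ?hall_height_ge0 // le_max lexx ?orbT.
Qed.

(** The sixth power clears both roots: it is the larger of |x|^3 and |y|^2. *)
Lemma hall_height_pow6_le x y B :
  (absz x)%:R ^+ 3 <= B -> (absz y)%:R ^+ 2 <= B -> hall_height R x y ^+ 6 <= B.
Proof.
move=> xB yB; rewrite /hall_height !intr_norm_absz.
case: (leP (_ `^ 2^-1)) => _; last by rewrite (exprM _ 2 3) (@powR_invK _ 1).
by rewrite (exprM _ 3 2) (@powR_invK _ 2).
Qed.

Lemma hall_height_le x y Z :
  0 <= Z -> (absz x)%:R <= Z ^+ 2 -> (absz y)%:R <= Z ^+ 3 ->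
  hall_height R x y <= Z.
Proof.
move=> Z0 xZ yZ; rewrite -(@ler_pXn2r _ 6) ?nnegrE ?hall_height_ge0 //.
apply: hall_height_pow6_le.
  by rewrite (exprM _ 2 3) lerXn2r ?nnegrE ?exprn_ge0.
by rewrite (exprM _ 3 2) lerXn2r ?nnegrE ?exprn_ge0.
Qed.

End HallHeight.

(** * The abc bound applied to the equation *)

(** The triple is u + (w - u) - w = 0, where u = x^3 / g and w = y^2 / g. Leaving [B] free lets the
    caller insert any upper bound for [g] times the radical. *)
Lemma abc_bound_gcd (R : realType) (eps K : R) (x y m : int) :
  0 < eps -> 0 <= K -> abc_bound eps K ->
  x != 0 -> y != 0 -> m != 0 -> y ^+ 2 = x ^+ 3 + m ->
  exists u v w g : nat,
    [/\ (absz x ^ 3 = u * g)%N, (absz m = v * g)%N, (absz y ^ 2 = w * g)%N,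
        g = gcdn (absz x ^ 3) (absz y ^ 2) &
        forall B : R, (g * radical (u * v * w))%:R <= B ->
          (absz x)%:R ^+ 3 <= K * B `^ (1 + eps) /\
          (absz y)%:R ^+ 2 <= K * B `^ (1 + eps)].
Proof.
move=> e0 K0 abc x0 y0 m0 eq_xy.
set g := gcdz (x ^+ 3) (y ^+ 2).
have g0 : g != 0 by rewrite gcdz_eq0 !expf_eq0 /= (negbTE x0).
have g1 : 1 <= (absz g)%:R :> R by rewrite ler1n absz_gt0.
have /dvdzP[u eu] : (g %| x ^+ 3)%Z by exact: dvdz_gcdl.
have /dvdzP[w ew] : (g %| y ^+ 2)%Z by exact: dvdz_gcdr.
have em : m = (w - u) * g by rewrite mulrBl -eu -ew eq_xy addrC addKr.
have u0 : u != 0 by have := expf_neq0 3 x0; rewrite eu mulf_eq0 => /norP[].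
have w0 : w != 0 by have := expf_neq0 2 y0; rewrite ew mulf_eq0 => /norP[].
have v0 : w - u != 0 by move: m0; rewrite em mulf_eq0 => /norP[].
have uw1 : gcdz u w = 1.
  apply: (mulIf g0); rewrite mul1r -[g in LHS]/(absz g)%:Z.
  by rewrite mulz_gcdl -eu -ew.
have cop : gcdz (gcdz u (w - u)) (- w) = 1.
  (* Modulo [u] the middle term is [w], so the first two terms are already coprime. *)
  by rewrite (_ : w - u = (- 1) * u + w) ?gcdzMDl ?uw1 ?gcd1z //; ring.
have uvw0 : u * (w - u) * - w != 0 by rewrite !mulf_neq0 ?oppr_eq0.
have sum0 : u + (w - u) + - w = 0 by ring.
have := abc u (w - u) (- w) uvw0 cop sum0.
rewrite !abszM abszN; set Q := radical _ => abcQ.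
have le_max_nat (t : int) : `|t| <= Num.max (Num.max `|u| `|w - u|) `|- w| ->
    (absz t)%:R <= K * Q%:R `^ (1 + eps) :> R.
  by move=> le_t; rewrite -intr_norm_absz; apply: le_trans abcQ; rewrite ler_int.
have bound (t : nat) (B : R) : (absz g * Q)%:R <= B ->
    t%:R <= K * Q%:R `^ (1 + eps) -> (t * absz g)%:R <= K * B `^ (1 + eps).
  move=> gQB tQ; rewrite natrM.
  apply: (le_trans (ler_wpM2r (ler0n _ _) tQ)); rewrite -mulrA ler_wpM2l // mulrC.
  apply: (@le_trans _ _ ((absz g * Q)%:R `^ (1 + eps))); last first.
    by apply: ge0_ler_powR; rewrite ?nnegrE ?ler0n ?(le_trans (ler0n _ _) gQB) //; lra.
  (* As [g] is at least 1, it may be moved inside the power 1 + eps. *)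
  by rewrite natrM; apply: le1r_powRZ; rewrite ?ler0n //; lra.
exists (absz u), (absz (w - u)), (absz w), (absz g); split.
- by rewrite -abszX eu abszM.
- by rewrite em abszM.
- by rewrite -abszX ew abszM.
- by rewrite /g /gcdz !abszX.
- move=> B gQB; rewrite -!natrX -!abszX eu ew !abszM.
  split; apply: bound => //; apply: le_max_nat; rewrite !le_max ?lexx //.
  by rewrite normrN lexx !orbT.
Qed.

(** * The explicit bound for a given solution *)

Section Bound.
Variables (R : realType) (S : {fset nat}) (D a x y : int).
Hypotheses (S_prime : prime_set S) (D0 : D != 0).
Hypothesis sol : S_primitive_solution S D a x y.

Let Z : nat := (N_ S * absz D)%N.

Let Z_gt0 : (0 < Z)%N.
Proof. by rewrite muln_gt0 N_gt0 // absz_gt0. Qed.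

Let a0 : a != 0.
Proof. by have [aS _ _] := sol; apply: S_units_neq0 aS. Qed.

(** [abc_bound] excludes triples with a zero term, so this case is treated directly: a D is y^2 or -
    x^3, and [dvdn_of_pow_eq] gives x | Z^2 or y | Z^3 for the nonzero coordinate. *)
Lemma S_primitive_solution_xy0 : x * y = 0 -> hall_height R x y <= Z%:R.
Proof.
have [aS eq_xy prim] := sol => xy0.
have N0 := N_gt0 S_prime.
have aD0 : a * D != 0 by rewrite mulf_neq0.
have abs_a : (0 < absz a)%N by rewrite absz_gt0.
have abs_D : (0 < absz D)%N by rewrite absz_gt0.
have aN p : prime p -> ~~ (p %| N_ S)%N -> ~~ (p %| absz a)%N.
  exact: S_units_dvdn.
have primN p : prime p -> (p %| N_ S)%N ->
    ~~ ((p ^ 6 %| absz x ^ 3) && (p ^ 6 %| absz y ^ 2))%N.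
  exact: S_primitive_ndvd.
apply: hall_height_le; rewrite ?ler0n // -natrX ler_nat.
  have [->|x0] := eqVneq x 0; first by [].
  have y0 : y = 0 by move/eqP: xy0; rewrite mulf_eq0 (negbTE x0) => /eqP.
  apply: dvdn_leq; first by rewrite expn_gt0 Z_gt0.
  apply: (@dvdn_of_pow_eq _ (absz a) _ _ 3) => //; first by rewrite absz_gt0.
    rewrite -abszM -abszX (_ : a * D = - (x ^+ 3)) ?abszN //.
    by apply/eqP; rewrite -addr_eq0 addrC -eq_xy y0 expr0n.
  by move=> p p_pr pN; have := primN p p_pr pN; rewrite y0 dvdn0 andbT.
have [->|y0] := eqVneq y 0; first by [].
have x0 : x = 0 by move/eqP: xy0; rewrite mulf_eq0 (negbTE y0) orbF => /eqP.
apply: dvdn_leq; first by rewrite expn_gt0 Z_gt0.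
apply: (@dvdn_of_pow_eq _ (absz a) _ _ 2) => //; first by rewrite absz_gt0.
  by rewrite -abszM -abszX eq_xy x0 expr0n add0r.
by move=> p p_pr pN; have := primN p p_pr pN; rewrite x0 dvdn0.
Qed.

Lemma S_primitive_solution_bound (eps K : R) :
  0 < eps -> eps <= 10^-1 -> abc_bound eps K ->
  hall_height R x y <= K `^ (1 + 10 * eps) * Z%:R `^ (1 + 12 * eps).
Proof.
move=> e0 e1 abc; have K1 := abc_bound_ge1 e0 e1 abc.
have Z1 : 1 <= Z%:R :> R by rewrite ler1n.
have [xy0|] := eqVneq (x * y) 0.
  (* Both factors of the target bound only enlarge [Z], because [K] and [Z] are at least 1. *)
  apply: (le_trans (S_primitive_solution_xy0 xy0)).
  apply: (@le_trans _ _ (Z%:R `^ (1 + 12 * eps))).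
    by apply: le1r_powR => //; lra.
  rewrite ler_peMl ?powR_ge0 //; apply: (le_trans K1).
  by apply: le1r_powR => //; lra.
rewrite mulf_eq0 => /norP[x0 y0].
have [aS eq_xy prim] := sol.
have aD0 : a * D != 0 by rewrite mulf_neq0.
have K0 : 0 <= K by lra.
have [u [v [w [g [eu ev ew eg bound]]]]] := abc_bound_gcd e0 K0 abc x0 y0 aD0 eq_xy.
have gQ_dvd : (g * radical (u * v * w) %| absz x * absz y * Z)%N.
  apply: (@gcd_radical_dvd _ _ _ (absz a)); rewrite ?N_gt0 ?absz_gt0 // -?abszM //.
    by move=> p; apply: S_units_dvdn.
  by move=> p; apply: S_primitive_ndvd.
have [xH yH] := absz_le_hall_height R x y.
set H := hall_height R x y in xH yH *.
have H0 : 0 <= H := hall_height_ge0 R x y.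
have H1 : 1 <= H.
  rewrite -(@ler_pXn2r _ 2) ?nnegrE // expr1n.
  by apply: le_trans xH; rewrite ler1n absz_gt0.
have := dvdn_leq _ gQ_dvd; rewrite !muln_gt0 !absz_gt0 x0 y0 D0 N_gt0 //.
move=> /(_ isT) le_gQ.
apply: descend_powR => //.
(* The choice of [B] comes from |x| <= H^2 and |y| <= H^3, which give |x y| Z <= H^5 Z. *)
have [|le_x le_y] := bound (H ^+ 5 * Z%:R); last exact: hall_height_pow6_le.
apply: (@le_trans _ _ (absz x * absz y * Z)%:R); first by rewrite ler_nat.
rewrite natrM ler_wpM2r ?ler0n // natrM (exprD H 2 3).
by rewrite ler_pM ?ler0n.
Qed.

End Bound.

Theorem theorem2p3 (R : realType) :
  (abc_conjecture R -> S_integral_weak_hall R) /\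
  (forall eps K : R,
     0 < eps -> eps <= 10^-1 -> abc_bound eps K ->
     forall (S : {fset nat}) (D a x y : int),
       prime_set S -> D != 0 -> S_primitive_solution S D a x y ->
       hall_height R x y
         <= K `^ (1 + 10 * eps)
            * (((N_ S)%:Z * `|D|)%:~R `^ (1 + 12 * eps))).
Proof.
split=> [abc eps eps0|eps K e0 e1 abc S D a x y S_prime D0 sol]; last first.
  by rewrite -abszE -PoszM; apply: S_primitive_solution_bound sol _ _ e0 e1 abc.
have [e [e0 e1 le_e]] : exists e : R, [/\ 0 < e, e <= 10^-1 & 12 * e <= eps].
  (* Small enough for the explicit bound, and 1 + 12 e <= 1 + eps. Both [e] and the constant built
     from it are fixed before [S] and [D]. *)
  exists (Num.min 10^-1 (eps / 12)); split.
  - by rewrite lt_min; apply/andP; split; lra.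
  - by rewrite ge_min lexx.
  - have : Num.min 10^-1 (eps / 12) <= eps / 12 by rewrite ge_min lexx orbT.
    lra.
have [K abcK] := abc e e0.
exists (K `^ (1 + 10 * e)) => S D a x y S_prime D0 sol.
apply: (le_trans (S_primitive_solution_bound S_prime D0 sol e0 e1 abcK)).
rewrite -abszE -PoszM ler_wpM2l ?powR_ge0 //; apply: ler_powR; last by lra.
by rewrite ler1n muln_gt0 N_gt0 // absz_gt0.
Qed.
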